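(* Let $G$ be a homeomorphism group of a topological space $X$. Then the existence of a dense orbit of $G$ implies topological transitivity of $G$. When $X$ is a Baire space with a countable base, the converse is also true: topological transitivity of $G$ implies the existence of a dense orbit of $G$.
   Context: A homeomorphism group of $X$ is a group of homeomorphisms of $X$ onto itself (no topology on the group is assumed). Every space on which a group acts is assumed to be infinite. The orbit of $x$ is $G.x=\{g.x : g\in G\}$. A homeomorphism group $G$ of $X$ is topologically transitive on $X$ if for all nonempty open subsets $U,V\subset X$ there exists $g\in G$ with $g(U)\cap V\ne\varnothing$. A Baire space is a topological space in which every countable intersection of open dense subsets is dense. *)

(* Defs.v *)
From mathcomp Require Import all_boot.
From mathcomp Require Import boolp classical_sets functions cardinality topology.

Set Implicit Arguments.
Unset Strict Implicit.
Unset Printing Implicit Defensive.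

Local Open Scope classical_set_scope.

Definition homeomorphism (X : topologicalType) (g : X -> X) : Prop :=
  exists h : X -> X,
    [/\ cancel g h, cancel h g, continuous g & continuous h].

(* A group of self-homeomorphisms under composition, given by its underlying
   set of maps. *)
Definition homeomorphism_group (X : topologicalType) (G : set (X -> X)) : Prop :=
  [/\ forall g, G g -> homeomorphism g,
      G id,
      forall g h, G g -> G h -> G (g \o h)
    & forall g, G g -> exists h, [/\ G h, cancel g h & cancel h g]].

Definition group_orbit (X : Type) (G : set (X -> X)) (x : X) : set X :=
  [set g x | g in G].

Definition topologically_transitive
    (X : topologicalType) (G : set (X -> X)) : Prop :=
  forall U V : set X, open U -> open V -> U !=set0 -> V !=set0 ->
    exists2 g, G g & (g @` U) `&` V !=set0.

Definition baire_space (X : topologicalType) : Prop :=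
  forall F : set (set X), countable F ->
    (forall A, F A -> open A /\ dense A) -> dense (\bigcap_(A in F) A).

(* Main.v *)
(* For the converse, each nonempty basic open set U has an open dense
   saturation, the union of the preimages of U under G, and any point lying in
   all these countably many saturations has a dense orbit. *)
Require Import Defs.
From mathcomp Require Import all_boot.
From mathcomp Require Import boolp classical_sets functions cardinality topology.

Local Open Scope classical_set_scope.

(** The orbit meets [U] at some [g x] and [V] at some [h x]; going back from [g x] to [x] and on to
    [h x] is an element of [G]. *)
Lemma dense_orbit_transitive (X : topologicalType) (G : set (X -> X)) (x : X) :
  homeomorphism_group G -> dense (group_orbit G x) ->
  topologically_transitive G.
Proof.
move=> [_ _ Gcomp Ginv] dx U V oU oV U0 V0.
have [_ [/[swap] [[g Gg <-]] Ugx]] := dx U U0 oU.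
have [_ [/[swap] [[h Gh <-]] Vhx]] := dx V V0 oV.
have [k [Gk gK _]] := Ginv g Gg.
exists (h \o k); first exact: Gcomp.
by exists (h x); split=> //; exists (g x) => //=; rewrite gK.
Qed.

Lemma open_saturation (X : topologicalType) (G : set (X -> X)) (U : set X) :
  homeomorphism_group G -> open U -> open (\bigcup_(g in G) g @^-1` U).
Proof.
move=> [homG _ _ _] oU; apply: bigcup_open => g Gg.
have [h [_ _ cg _]] := homG g Gg.
by apply: open_comp oU => y _; exact: cg.
Qed.

(** Transitivity for the pair [O], [U] gives a point of [O] that some [g] sends into [U]. *)
Lemma dense_saturation (X : topologicalType) (G : set (X -> X)) (U : set X) :
  topologically_transitive G -> open U -> U !=set0 ->
  dense (\bigcup_(g in G) g @^-1` U).
Proof.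
move=> trG oU U0 O O0 oO.
have [g Gg [_ [[y Oy <-] Ugy]]] := trG O U oO oU O0 U0.
by exists y; split=> //; exists g.
Qed.

Lemma transitive_dense_orbit (X : topologicalType) (G : set (X -> X)) :
  [set: X] !=set0 -> homeomorphism_group G -> baire_space X ->
  @second_countable X -> topologically_transitive G ->
  exists x : X, dense (group_orbit G x).
Proof.
move=> X0 homG baireX [B cB [oB basisB]] trG.
pose sat U := \bigcup_(g in G) g @^-1` U.
(* The empty set is left out of the base because its saturation is empty, hence not dense when [X]
   has a point. *)
have cF : countable (sat @` (B `&` [set U | U !=set0])).
  apply: card_le_trans (card_image_le _ _) _.
  exact: sub_countable (subset_card_le (@subIsetl _ _ _)) cB.
have odF A : (sat @` (B `&` [set U | U !=set0])) A -> open A /\ dense A.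
  move=> [U [BU U0] <-]; have oU := oB U BU.
  by split; [exact: open_saturation|exact: dense_saturation].
(* Density tested against the whole nonempty space yields one point common to all the
   saturations. *)
have [x [_ satx]] := baireX _ cF odF _ X0 openT.
exists x => O [y Oy] oO.
(* Shrinking [O] to a basic [U] around [y] lets [satx] apply: some [g] sends [x] into [U], hence
   into [O]. *)
have [U [BU Uy] UO] := basisB y O (open_nbhs_nbhs (conj oO Oy)).
have [|g Gg Ugx] := satx (sat U); first by exists U => //; split=> //; exists y.
by exists (g x); split; [exact: UO|exists g].
Qed.

Theorem proposition3p4 (X : topologicalType) (G : set (X -> X))
    (infX : infinite_set [set: X]) (homeoG : homeomorphism_group G) :
  ((exists x : X, dense (group_orbit G x)) -> topologically_transitive G) /\
  (baire_space X -> @second_countable X ->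
     topologically_transitive G -> exists x : X, dense (group_orbit G x)).
Proof.
split; first by move=> [x]; exact: dense_orbit_transitive.
by apply: transitive_dense_orbit => //; exact: infinite_setN0.
Qed.
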